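(* Let $\mathbb{F}_q$ be a finite field and let $k,t,n,\eta,\epsilon$ be integers with $1\le t\le k$, $1\le\eta\le n-2$, $0\le\epsilon<t$ and $n\le\frac{q^{t(n-\eta)}-1}{q^t-1}$. Then there exist a vector space $\mathcal{V}$ over $\mathbb{F}_q$ and a $(k,k-t)$-SCID $\{\pi_1,\ldots,\pi_n\}$ in $\mathcal{V}$ with $n$ elements such that \[\dim S+\dim I=2k+(n-2)t-\eta t+\epsilon,\] where $S:=\langle\pi_1,\ldots,\pi_n\rangle$ and $I:=\langle \pi_i\cap\pi_j\mid i\neq j\rangle$.
   Context: A $(k,k-t)$-SCID is a set of (distinct) $k$-dimensional subspaces of a vector space, containing at least two elements, such that any two distinct members intersect in a subspace of dimension exactly $k-t$. $\langle\cdot\rangle$ denotes the span. The dimension of the ambient vector space is not fixed in advance. *)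

(* Defs.v *)
From HB Require Import structures.
From mathcomp Require Import all_boot all_order all_algebra.
Set Implicit Arguments.
Unset Strict Implicit.
Unset Printing Implicit Defensive.
Import GRing.Theory.

Definition is_SCID (F : fieldType) (V : vectType F) (k m : nat)
    (A : {pred {vspace V}}) : Prop :=
  [/\ exists U W : {vspace V}, [/\ U \in A, W \in A & U != W],
      forall U : {vspace V}, U \in A -> \dim U = k
    & forall U W : {vspace V}, U \in A -> W \in A -> U != W ->
        \dim (U :&: W) = m].

Definition SCID_span (F : fieldType) (V : vectType F) (n : nat)
    (p : 'I_n -> {vspace V}) : {vspace V} :=
  (\sum_(i < n) p i)%VS.

Definition SCID_meet_span (F : fieldType) (V : vectType F) (n : nat)
    (p : 'I_n -> {vspace V}) : {vspace V} :=
  (\sum_(i < n) \sum_(j < n | i != j) (p i :&: p j))%VS.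

(* Main.v *)
Require Import Defs.
From HB Require Import structures.
From mathcomp Require Import all_boot all_order all_fingroup all_algebra.
From mathcomp Require Import all_solvable all_field zify.
Set Implicit Arguments.
Unset Strict Implicit.
Unset Printing Implicit Defensive.
Import GRing.Theory.
Local Open Scope ring_scope.

(** Let K be a (k-t)-dimensional subspace of V.  If T_1, ..., T_n are t-spaces
    that meet pairwise trivially in V/K and span it, then their preimages in V
    meet pairwise exactly in K, so dim S + dim I = 2(k-t) + dim (V/K); it remains
    to find such T_i spanning a space of dimension (n-eta)t + eps.  For eps = 0
    take n one-dimensional L-subspaces of L^(n-eta), the coordinate axes among
    them, where L is the extension of F of degree t.  For eps > 0, replace every
    chosen subspace other than the axes by the graph of a surjective F-linear map
    onto F^eps: graphs still meet trivially and, as n > n-eta, there is at least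
    one, so that L^(n-eta) x F^eps is spanned. *)

Lemma natr_card_finField (F : finFieldType) : #|F|%:R = 0 :> F.
Proof.
have := expg_cardG (in_setT (1 : F)).
by rewrite cardsT FinRing.zmodXgE.
Qed.

(** [L] is the splitting field of $X^m - X$ with $m = q^t$, $q$ the order of [F]. Its $m$ distinct
    roots turn out to be all of [L], so $q^{[L:F]} = q^t$. *)
Lemma exists_fieldExt_of_degree (F : finFieldType) (t : nat) :
  (0 < t)%N -> exists L : fieldExtType F, \dim {:L} = t.
Proof.
move=> t_gt0; have q_gt1 : (1 < #|F|)%N := finNzRing_gt1 F.
set m := (#|F| ^ t)%N; have m_gt1 : (1 < m)%N by rewrite -(exp1n t) ltn_exp2r.
have szP (R : nzRingType) : size ('X^m - 'X : {poly R}) = m.+1.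
  by rewrite size_polyDl size_polyXn // size_polyN size_polyX.
have /FinSplittingFieldFor[L] : 'X^m - 'X != 0 :> {poly F}.
  by rewrite -size_poly_eq0 szP.
rewrite [map_poly _ _]rmorphB rmorphXn /= map_polyX => -[zs DP defL].
exists L; pose K := FinFieldExtType L.
have m0 : m%:R = 0 :> L.
  rewrite -(rmorph_nat (in_alg L)) natrX natr_card_finField.
  by rewrite expr0n gtn_eqF // rmorph0.
(* The derivative of $X^m - X$ is $-1$, because $m = 0$ in [L]. *)
have Uzs : uniq zs.
  rewrite -separable_prod_XsubC -(eqp_separable DP) separable_poly.unlock.
  rewrite derivB derivXn derivX -mulr_natr -polyC_natr m0 mulr0 sub0r.
  rewrite -[X in coprimep _ X]scaleN1r coprimepZr ?coprimep1 //.
  by rewrite oppr_eq0 oner_eq0.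
(* [a] is the Frobenius map $x \mapsto x^q$, so [a ^+ t] is $x \mapsto x^m$ and fixes exactly the
   roots. *)
have [a _ Da] := finField_galois_generator (sub1v {:L}).
have fixE : fixedSpace (a ^+ t)%g =i zs.
  move=> z; rewrite -root_prod_XsubC -(eqp_root DP) (sameP fixedSpaceP eqP).
  rewrite /root !hornerE subr_eq0; congr (_ == z); rewrite /m.
  elim: (t) => [|i IHi]; first by rewrite gal_id.
  by rewrite expgSr galM ?memvf // IHi Da ?memvf // dimv1 expn1 -exprM -expnSr.
(* The roots form a subfield containing [F], and they generate [L]. *)
have zsT x : x \in zs.
  rewrite -fixE; suff -> : fixedSpace (a ^+ t)%g = {:L}%VS by exact: memvf.
  apply/eqP; rewrite eqEsubv subvf -defL -[X in (_ <= X)%VS]subfield_closed.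
  by rewrite agenvS // subv_add sub1v; apply/span_subvP => z; rewrite fixE.
have cK : #|K| = m.
  have /eq_card -> : K =i (zs : seq K) by move=> x; rewrite zsT.
  rewrite (card_uniqP _) //; apply: succn_inj.
  by rewrite -(size_prod_XsubC _ id) -(eqp_size DP) szP.
apply: (expnI q_gt1).
by rewrite -[RHS]cK -(@card_vspace F K) (@card_vspacef F K).
Qed.

(* Greedy choice: n vectors have at most n (#|K| - 1) nonzero multiples, so while
   this is less than #|K|^m - 1 a further vector can be added. *)
Lemma exists_nonproportional_rows (K : finFieldType) (m d : nat) :
  ((m + d) * #|K|.-1 <= (#|K| ^ m).-1)%N ->
  exists v : 'I_(m + d) -> 'rV[K]_m,
    [/\ forall i, v i != 0,
        forall i j c, i != j -> v i <> c *: v j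
      & forall (i : 'I_(m + d)) (l : 'I_m), i = l :> nat -> v i = delta_mx 0 l].
Proof.
have K1 : (0 < #|K|.-1)%N by case: #|K| (finNzRing_gt1 K) => [|[]].
elim: d => [_|d IHd].
  rewrite addn0; exists (fun i => delta_mx 0 i).
  split=> [i|i j c ij|i l /val_inj-> //].
    by apply/eqP => /rowP /(_ i) /eqP; rewrite !mxE !eqxx oner_eq0.
  by move/rowP => /(_ i) /eqP; rewrite !mxE !eqxx (negPf ij) mulr0 oner_eq0.
rewrite addnS => le_n.
have lt_n : ((m + d) * #|K|.-1 < (#|K| ^ m).-1)%N.
  by apply: leq_trans le_n; rewrite ltn_pmul2r.
have [v [v0 vP vE]] := IHd (ltnW lt_n).
pose B := [set x.1 *: v x.2 | x in setX [set~ 0] [set: 'I_(m + d)]].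
have [w] : exists w, w \in [set~ 0] :\: B.
  apply/set0Pn; rewrite -card_gt0 -subn_gt0 subn0 cardsD subn_gt0.
  apply: leq_ltn_trans (subset_leq_card (subsetIr _ _)) _.
  apply: leq_ltn_trans (leq_imset_card _ _) _.
  by rewrite cardsX !cardsC1 cardsT card_ord card_mx mul1n mulnC.
rewrite !inE => /andP[wB w0].
(* The new vector [w] goes last, so the unit vectors keep the first [m] indices. *)
exists (fun i => oapp v w (unlift ord_max i)); split=> [i|i j c|i l].
- by case: unliftP => [j _|_] /=.
- case: unliftP => [i' ->|->]; case: unliftP => [j' ->|->] //=.
  + by rewrite (inj_eq lift_inj); apply: vP.
  + have [->|c0] := eqVneq c 0.
      by rewrite scale0r => _ /eqP; rewrite (negPf (v0 _)).
    move=> _ /(canLR (scalerK c0)) wE; case/imsetP: wB.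
    by exists (c^-1, i'); rewrite // !inE invr_eq0 c0.
  + have [->|c0] := eqVneq c 0.
      by rewrite scale0r => _ /eqP; rewrite (negPf w0).
    by move=> _ wE; case/imsetP: wB; exists (c, j'); rewrite // !inE c0.
  + by rewrite eqxx.
- case: unliftP => [j ->|->]; first by rewrite lift_max; apply: vE.
  by move=> E; have := ltn_ord l; rewrite -E /= ltnNge leq_addr.
Qed.

(** Send the first basis vectors of [aT] to the basis of [rT], the others to 0. *)
Lemma exists_lfun_limg_full (K : fieldType) (aT rT : vectType K) :
  (\dim {:rT} <= \dim {:aT})%N ->
  exists f : 'Hom(aT, rT), limg f = fullv.
Proof.
move=> le_dim; pose w := widen_ord le_dim.
pose f (u : aT) := \sum_i coord (vbasis {:aT}) (w i) u *: (vbasis {:rT})`_i.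
have fL : linear f.
  move=> c u u'; rewrite /f scaler_sumr -big_split; apply: eq_bigr => i _.
  by rewrite linearP scalerDl scalerA.
pose fM := GRing.isLinear.Build _ _ _ _ f fL.
pose fH : {linear aT -> rT} := HB.pack f fM.
exists (linfun fH); apply/vspaceP => y; rewrite memvf; apply/memv_imgP.
exists (\sum_i coord (vbasis {:rT}) i y *: (vbasis {:aT})`_(w i)).
  exact: memvf.
have wE (i j : 'I_(\dim {:rT})) :
    coord (vbasis {:aT}) (w i) (vbasis {:aT})`_j = (j == i)%:R.
  exact: (coord_free (w j) (w i) (basis_free (vbasisP _))).
rewrite lfunE [LHS](coord_vbasis (memvf y)); apply: eq_bigr => i _.
rewrite linear_sum (bigD1 i) //= linearZ /= wE eqxx mulr1.
rewrite big1 ?addr0 // => j ji.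
by rewrite linearZ /= wE (negPf ji) mulr0.
Qed.

(** Rank-nullity on the preimage, which contains the kernel and maps onto [U]. *)
Lemma dim_lpreim (K : fieldType) (aT rT : vectType K) (f : 'Hom(aT, rT)) U :
  limg f = fullv -> \dim (f @^-1: U) = (\dim (lker f) + \dim U)%N.
Proof.
move=> fT; rewrite -(limg_ker_dim f) lpreimK ?fT ?subvf // (capv_idPr _) //.
by rewrite -lpreim0 lpreimS ?sub0v.
Qed.

Lemma lpreim_cap (K : fieldType) (aT rT : vectType K) (f : 'Hom(aT, rT)) U W :
  (f @^-1: U :&: f @^-1: W = f @^-1: (U :&: W))%VS.
Proof. by apply/vspaceP => u; rewrite memv_cap -!memv_preim memv_cap. Qed.

Lemma exists_spanning_partial_spread (F : finFieldType) (t m n eps : nat) :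
  (0 < t)%N -> (eps <= t)%N -> (m < n)%N ->
  (n * (#|F| ^ t).-1 <= (#|F| ^ (t * m)).-1)%N ->
  exists (V : vectType F) (T : 'I_n -> {vspace V}),
    [/\ forall i, \dim (T i) = t,
        forall i j, i != j -> (T i :&: T j = 0)%VS,
        (\sum_i T i = fullv)%VS
      & \dim {:V} = (m * t + eps)%N].
Proof.
move=> t_gt0 le_eps lt_mn.
have [d d_gt0 ->] : exists2 d, (0 < d)%N & n = (m + d)%N.
  by exists (n - m)%N; rewrite ?subn_gt0 // subnKC // ltnW.
have [L dimL] := exists_fieldExt_of_degree F t_gt0.
have cL : #|FinFieldExtType L| = (#|F| ^ t)%N.
  rewrite -dimL -(@card_vspace F (FinFieldExtType L)).
  by rewrite (@card_vspacef F (FinFieldExtType L)).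
rewrite expnM -cL => /exists_nonproportional_rows[v [v0 vP vE]].
have {}v0 i (a : L) : (forall l, a * v i 0 l = 0) -> a = 0.
  move=> va; apply/eqP/negPn/negP => a0; case/eqP: (v0 i); apply/rowP => l.
  by apply: (mulfI a0); rewrite mxE mulr0 va.
have {}vP i j (a b : L) :
    i != j -> (forall l, a * v i 0 l = b * v j 0 l) -> a = 0.
  move=> ij vab; apply/eqP/negPn/negP => a0.
  apply: (vP i j (a^-1 * b)) => //; apply/rowP => l.
  by rewrite mxE -mulrA -vab mulKf.
have {}vE (i : 'I_(m + d)) (l l' : 'I_m) :
    i = l :> nat -> v i 0 l' = (l == l')%:R :> L.
  by move=> /vE ->; rewrite mxE eqxx eq_sym.
(* Here [eps <= t] is used. For [eps = 0] the target is the zero space, so both cases are treated at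
   once. *)
have [phi phiT] : exists phi : 'Hom(L, 'rV[F]_eps), limg phi = fullv.
  by apply: exists_lfun_limg_full; rewrite dimL dimvf /dim /= mul1n.
(* The image of [g i] is the axis itself for [i < m], otherwise the graph over the line $L v_i$. The
   first component alone yields injectivity and trivial meets. *)
pose g i (a : L) : {ffun 'I_m -> L} * 'rV[F]_eps :=
  ([ffun l => a * v i 0 l], if (i < m)%N then 0 else phi a).
have gL i : linear (g i).
  move=> c a b; congr (_, _).
    by apply/ffunP => l; rewrite !ffunE mulrDl scalerAl.
  by rewrite /=; case: ifP => _; [rewrite scaler0 addr0 | rewrite linearP].
pose gM i := GRing.isLinear.Build _ _ _ _ (g i) (gL i).
pose G i : {linear L -> _} := HB.pack (g i) (gM i).
pose h i := linfun (G i).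
have hE i a : h i a = g i a by rewrite lfunE.
exists ({ffun 'I_m -> L} * 'rV[F]_eps)%type, (fun i => limg (h i)).
split=> [i|i j ij||].
- rewrite limg_dim_eq ?dimL //; apply/eqP; rewrite -subv0; apply/subvP => a.
  rewrite memv_cap memv_ker memv0 hE => /andP[_ /eqP[/ffunP g0 _]].
  by apply/eqP/(v0 i) => l; have := g0 l; rewrite !ffunE.
- apply/eqP; rewrite -subv0; apply/subvP => _ /memv_capP[/memv_imgP[a _ ->]].
  case/memv_imgP=> b _; rewrite !hE memv0 => E.
  have -> : a = 0; last by rewrite -(hE i) linear0.
  apply: (vP i j a b ij) => l; have [/ffunP /(_ l)] := E.
  by rewrite !ffunE.
- apply/eqP; rewrite eqEsubv subvf; apply/subvP => -[x y] _.
  have hS i a : g i a \in (\sum_i limg (h i))%VS.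
    by rewrite -hE memvE (sumv_sup i) // -memvE memv_img ?memvf.
  (* The axes already span $L^m \times 0$. *)
  have xS x' : (x', 0) \in (\sum_i limg (h i))%VS.
    have -> : (x', 0) = \sum_l g (lshift d l) (x' l).
      rewrite [RHS]surjective_pairing; congr (_, _).
        rewrite (big_morph fst (id1 := 0) (op1 := +%R)) //.
        apply/ffunP => l'; rewrite sum_ffunE (bigD1 l') //= ffunE.
        rewrite (vE _ l') // eqxx mulr1 big1 ?addr0 // => l ll'.
        by rewrite ffunE (vE _ l) // (negPf ll') mulr0.
      rewrite (big_morph snd (id1 := 0) (op1 := +%R)) // big1 // => l _ /=.
      by rewrite ltn_ord.
    by apply: rpred_sum => l _.
  have /memv_imgP[a _ ya] : y \in limg phi by rewrite phiT memvf.
  (* A single graph, the one at index [m], reaches every [y] modulo $L^m \times 0$. *)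
  pose r := rshift m (Ordinal d_gt0).
  have -> : (x, y) = g r a + (x - [ffun l => a * v r 0 l], 0).
    by congr (_, _); rewrite /= ?ltnNge ?leq_addr ?addr0 // addrC subrK.
  by rewrite rpredD.
- rewrite dimvf -[LHS]/(#|'I_m| * dim L + 1 * eps)%N.
  by rewrite card_ord -dimvf dimL mul1n.
Qed.

Local Close Scope ring_scope.

Theorem theorem8 (F : finFieldType) (k t n eta eps : nat) :
  1 <= t <= k ->
  1 <= eta <= n - 2 ->
  0 <= eps < t ->
  n <= (#|F| ^ (t * (n - eta)) - 1) %/ (#|F| ^ t - 1) ->
  exists (V : vectType F) (p : 'I_n -> {vspace V}),
    [/\ injective p,
        is_SCID k (k - t) [in codom p]
      & \dim (SCID_span p) + \dim (SCID_meet_span p)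
        = 2 * k + (n - 2) * t - eta * t + eps].
Proof.
move=> /andP[t_gt0 le_tk] /andP[eta_gt0 le_eta] /andP[_ lt_eps] le_n.
have [||||V0 [T [dimT capT sumT dimV0]]] :=
    @exists_spanning_partial_spread F t (n - eta) n eps.
- by [].
- exact: ltnW.
- by lia.
- rewrite -!subn1; apply: leq_trans (leq_trunc_div _ (#|F| ^ t - 1)).
  by rewrite leq_mul2r le_n orbT.
(* The kernel of the first projection [f] serves as $K$, so [V0] stands for $V/K$. *)
pose V : vectType F := (V0 * 'rV[F]_(k - t))%type.
pose f : 'Hom(V, V0) := linfun fst.
have fT : limg f = fullv.
  apply/vspaceP => u; rewrite memvf; apply/memv_imgP.
  by exists (u, 0%R); rewrite ?memvf // lfunE.
have dim_ker : \dim (lker f) = k - t.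
  apply/eqP; rewrite -(eqn_add2r (\dim {:V0})) -{1}fT -{1}(capfv (lker f)).
  rewrite limg_ker_dim !dimvf addnC -[X in X == _]/(dim V0 + 1 * (k - t)).
  by rewrite mul1n.
pose p i := (f @^-1: T i)%VS.
have capP i j : i != j -> (p i :&: p j)%VS = lker f.
  by move=> ij; rewrite lpreim_cap capT // lpreim0.
have dimP i : \dim (p i) = k by rewrite dim_lpreim // dim_ker dimT subnK.
have p_inj : injective p.
  (* Equal members would coincide with the kernel, of dimension $k - t < k$. *)
  move=> i j pij; apply/eqP/negPn/negP => /capP; rewrite pij capvv => pE.
  by have := dimP j; rewrite pE dim_ker; lia.
have [n_gt0 n_gt1] : 0 < n /\ 1 < n by lia.
pose i0 := Ordinal n_gt0; pose i1 := Ordinal n_gt1.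
exists V, p; split=> //.
  split.
  - by exists (p i0), (p i1); rewrite ?codom_f (inj_eq p_inj).
  - by move=> _ /codomP[i ->].
  - move=> _ _ /codomP[i ->] /codomP[j ->]; rewrite (inj_eq p_inj) => /capP ->.
    exact: dim_ker.
have ker_p i : (lker f <= p i)%VS by rewrite -lpreim0 lpreimS ?sub0v.
have -> : SCID_meet_span p = lker f.
  apply/eqP; rewrite eqEsubv; apply/andP; split.
    by apply/subv_sumP => i _; apply/subv_sumP => j ij; rewrite capP.
  by apply: (sumv_sup i0) => //; apply: (sumv_sup i1) => //; rewrite capP.
have -> : SCID_span p = fullv.
  (* The span contains the kernel and its image under [f] is the sum of the [T i], which is [V0]. *)
  apply/eqP; rewrite eqEdim subvf /= -(limg_ker_dim f (SCID_span p)).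
  rewrite limg_sum (eq_bigr T) => [|i _]; last by rewrite lpreimK // fT subvf.
  rewrite sumT (capv_idPr _); last by apply: (sumv_sup i0).
  by rewrite -(limg_ker_dim f fullv) capfv fT.
rewrite -(limg_ker_dim f fullv) capfv fT dim_ker dimV0.
(* As [eta <= n - 2], no subtraction truncates: both sides are $2(k-t) + (n-\eta)t + \epsilon$. *)
nia.
Qed.
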